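(* Let $A$ and $B$ be Banach algebras such that $B$ is a Banach $A$-bimodule. Let $T:A\to B$ be a bounded linear operator, and let $m:A\times B\to B$ be the bounded bilinear mapping $m(a,b)=T(a)b$ for $a\in A$, $b\in B$, where $T(a)b$ denotes the product in the Banach algebra $B$. Then: (a) If $B$ is Arens regular, then $m$ is Arens regular. (b) If $T$ is surjective, then: (i) $B$ is Arens regular if and only if $m$ is Arens regular. (ii) If $m$ is left strongly Arens irregular, then $B$ is left strongly Arens irregular. (iii) If $T$ is moreover injective, then $B$ is left strongly Arens irregular if and only if $m$ is left strongly Arens irregular.
   Context: For normed spaces $X,Y,Z$ and a bounded bilinear map $m:X\times Y\to Z$, define bounded bilinear maps $m^*:Z^*\times X\to Y^*$ by $\langle m^*(z',x),y\rangle=\langle z',m(x,y)\rangle$; $m^{**}:Y^{**}\times Z^*\to X^*$ by $\langle m^{**}(y'',z'),x\rangle=\langle y'',m^*(z',x)\rangle$; $m^{***}:X^{**}\times Y^{**}\to Z^{**}$ by $\langle m^{***}(x'',y''),z'\rangle=\langle x'',m^{**}(y'',z')\rangle$. Let $m^t:Y\times X\to Z$, $m^t(y,x)=m(x,y)$, be the transpose of $m$. Applying the same construction to $m^t$ gives $m^{t***}:Y^{**}\times X^{**}\to Z^{**}$, and $m^{t***t}:X^{**}\times Y^{**}\to Z^{**}$ is its transpose. The map $m$ is called Arens regular if $m^{***}=m^{t***t}$. The first topological center of $m$ is $$Z_1(m)=\{x''\in X^{**}: y''\mapsto m^{***}(x'',y'')\text{ is weak}^*\text{-weak}^*\text{ continuous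 on }Y^{**}\}.$$ The map $m$ is called left strongly Arens irregular if $Z_1(m)=X$, where $X$ is identified with its canonical image in $X^{**}$. A Banach algebra $B$ is called Arens regular (respectively left strongly Arens irregular) if its multiplication $B\times B\to B$ is Arens regular (respectively left strongly Arens irregular) as a bilinear map. *)

(* Defs.v *)
From HB Require Import structures.
From mathcomp Require Import all_boot all_order all_algebra.
From mathcomp Require Import all_classical all_reals all_analysis.
From mathcomp Require Import complex.

Set Implicit Arguments.
Unset Strict Implicit.
Unset Printing Implicit Defensive.

Import Order.TTheory GRing.Theory Num.Theory.
Import numFieldNormedType.Exports.

Local Open Scope classical_set_scope.
Local Open Scope ring_scope.
Local Open Scope complex_scope.

(* Normed spaces are taken over R or over C = R[i]. In both cases norms take
   their values in the scalar field itself, among its nonnegative elements. *)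
Variant scalars := RealScalars | ComplexScalars.

Definition scalar_field (R : realType) (s : scalars) : numFieldType :=
  match s with RealScalars => R | ComplexScalars => R[i] end.

Arguments scalar_field : simpl never.

Lemma scalar_field_inf (R : realType) (s : scalars)
    (A : set (scalar_field R s)) :
  A !=set0 -> (forall a, A a -> 0 <= a) ->
  exists c, lbound A c /\ forall d, lbound A d -> d <= c.
Proof.
case: s A => /= A A0 Age0.
  have Alb : has_lbound A by exists 0.
  exists (inf A); split; first exact: ge_inf.
  by move=> d dA; exact: lb_le_inf.
pose S : set R := [set x | A x%:C].
have AE a : A a -> a = (complex.Re a)%:C.
  by move=> /Age0; case: a => x y; rewrite lecE /= => /andP[/eqP -> _].
have S0 : S !=set0.
  by case: A0 => a Aa; exists (complex.Re a); rewrite /S /= -AE.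
have Sge0 x : S x -> 0 <= x by move=> /Age0; rewrite lecR.
have Slb : has_lbound S by exists 0.
exists (inf S)%:C; split.
  move=> a Aa; rewrite (AE _ Aa) lecR; apply: (ge_inf Slb).
  by rewrite /S /= -AE.
move=> [x y] dA.
have y0 : y = 0.
  case: A0 => a Aa; have := dA _ Aa; rewrite (AE _ Aa) lecE /= eq_sym.
  by case/andP=> /eqP.
rewrite y0 in dA *; rewrite -/(x%:C) lecR; apply: lb_le_inf => // z Sz.
by have := dA _ Sz; rewrite lecR.
Qed.

Section BoundedMaps.
Variable K : numFieldType.

Definition bounded_operator (X Y : normedModType K) (f : X -> Y) : Prop :=
  exists M : K, forall x, `|f x| <= M * `|x|.

Record bounded_bilinear (X Y Z : normedModType K) := BoundedBilinear {
  bbmap :> {bilinear X -> Y -> Z} ;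
  bbmapP : exists M : K, forall x y, `|bbmap x y| <= M * `|x| * `|y| }.

End BoundedMaps.

Section Dual.
Variables (R : realType) (s : scalars).
Local Notation K := (scalar_field R s).
Variable X : normedModType K.

Definition dual_pred : {pred X -> K^o} :=
  mem [set f : X -> K^o | linear f /\ bounded_operator f].

Lemma dual_submod_closed : submod_closed dual_pred.
Proof.
split=> [|a f g].
  rewrite inE; split=> [k x y|]; first by rewrite /= scaler0 addr0.
  by exists 0 => x; rewrite normr0 mul0r.
rewrite !inE => -[lf [M hM]] [lg [N hN]]; split.
  move=> k x y.
  rewrite -![(_ + _ : X -> K^o) _]/(_ + _) -![(_ *: _ : X -> K^o) _]/(_ *: _).
  rewrite lf lg !scalerDr !scalerA (mulrC k a) -!addrA; congr (_ + _).
  by rewrite !addrA; congr (_ + _); rewrite addrC.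
exists (`|a| * M + N) => x.
rewrite (le_trans (ler_normD _ _))// mulrDl lerD ?hN//.
by rewrite -mulrA; rewrite normrZ ler_wpM2l.
Qed.

HB.instance Definition _ :=
  GRing.isSubmodClosed.Build K (X -> K^o) dual_pred dual_submod_closed.

Record dual := Dual { dual_fun :> X -> K^o ; dual_funP : dual_fun \in dual_pred }.

HB.instance Definition _ := [isSub for dual_fun].
HB.instance Definition _ := gen_eqMixin dual.
HB.instance Definition _ := gen_choiceMixin dual.
HB.instance Definition _ := [SubChoice_isSubLmodule of dual by <:].

Lemma dual_linear (f : dual) : linear f.
Proof. by case: f => f /=; rewrite inE => -[]. Qed.

HB.instance Definition _ (f : dual) :=
  GRing.isLinear.Build K X K^o *:%R f (dual_linear f).

Lemma dual_bounded (f : dual) : bounded_operator f.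
Proof. by case: f => f /=; rewrite inE => -[]. Qed.

Lemma dual_ext (f g : dual) : (forall x, f x = g x) -> f = g.
Proof. by move=> fg; apply: val_inj; apply/funext. Qed.

Definition dual_bounds (f : dual) : set K :=
  [set M | 0 <= M /\ forall x, `|f x| <= M * `|x|].

(* The operator norm: the least M >= 0 such that |f x| <= M |x| for all x. It
   exists by [dual_normP], so that the default value 0 is never used. *)
Definition dual_norm (f : dual) : K :=
  xget 0 (dual_bounds f `&` lbound (dual_bounds f)).

Lemma dual_normP (f : dual) :
  dual_bounds f (dual_norm f) /\ lbound (dual_bounds f) (dual_norm f).
Proof.
suff [c cP] : exists c, (dual_bounds f `&` lbound (dual_bounds f)) c.
  by rewrite /dual_norm; case: xgetP => [y _ []//|/(_ c)].
have [M hM] := dual_bounded f.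
have bnd0 : dual_bounds f !=set0.
  have [X0|[x x0]] : (forall x : X, x = 0) \/ (exists x : X, x != 0).
    have [|/existsNP[x /eqP]] := pselect (forall x : X, x = 0); first by left.
    by right; exists x.
    by exists 0; split=> // x; rewrite (X0 x) linear0 !normr0 mulr0.
  exists M; split=> //; rewrite -(pmulr_lge0 _ (_ : 0 < `|x|)) ?normr_gt0//.
  exact: le_trans (hM x).
have [c [clb cglb]] := scalar_field_inf bnd0 (fun a => @proj1 _ _).
exists c; split=> //; split.
  by apply: cglb => d [].
move=> x; have [->|x0] := eqVneq x 0; first by rewrite linear0 !normr0 mulr0.
rewrite -ler_pdivrMr ?normr_gt0//; apply: cglb => d [_ /(_ x)].
by rewrite ler_pdivrMr ?normr_gt0.
Qed.

Lemma dual_norm_ge0 (f : dual) : 0 <= dual_norm f.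
Proof. by have [[]] := dual_normP f. Qed.

Lemma dual_norm_le (f : dual) x : `|f x| <= dual_norm f * `|x|.
Proof. by have [[]] := dual_normP f. Qed.

Lemma dual_norm_min (f : dual) M :
  0 <= M -> (forall x, `|f x| <= M * `|x|) -> dual_norm f <= M.
Proof. by move=> M0 hM; have [_] := dual_normP f; apply. Qed.

Lemma dual_normD (f g : dual) : dual_norm (f + g) <= dual_norm f + dual_norm g.
Proof.
apply: dual_norm_min => [|x]; first by rewrite addr_ge0 ?dual_norm_ge0.
by rewrite mulrDl (le_trans (ler_normD _ _))// lerD ?dual_norm_le.
Qed.

Lemma dual_normZ_le (l : K) (f : dual) :
  dual_norm (l *: f) <= `|l| * dual_norm f.
Proof.
apply: dual_norm_min => [|x]; first by rewrite mulr_ge0 ?dual_norm_ge0.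
by rewrite -[(l *: f) x]/(l *: f x) normrZ -mulrA ler_wpM2l ?dual_norm_le.
Qed.

Lemma dual_norm_eq0 (f : dual) : dual_norm f = 0 -> f = 0.
Proof.
move=> f0; apply: dual_ext => x; apply/eqP; rewrite -normr_le0.
by have := dual_norm_le f x; rewrite f0 mul0r.
Qed.

Lemma dual_normZ (l : K) (f : dual) : dual_norm (l *: f) = `|l| * dual_norm f.
Proof.
apply/eqP; rewrite eq_le dual_normZ_le /=.
have [->|l0] := eqVneq l 0; first by rewrite normr0 mul0r dual_norm_ge0.
rewrite -ler_pdivlMl ?normr_gt0// -normfV.
by rewrite -{1}[f](scalerK l0) dual_normZ_le.
Qed.

HB.instance Definition _ :=
  Lmodule_isNormed.Build K dual dual_normD dual_normZ dual_norm_eq0.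

Definition mk_dual (f : X -> K^o) (lf : linear f) (bf : bounded_operator f) :
  dual := Dual (mem_set (conj lf bf)).

(* The weak* topology: the coarsest one making all f |-> f x continuous. *)
Definition weak_star : topologicalType :=
  initial_topology (fun f : dual => (f : {ptws X -> K^o})).

End Dual.

Section Bilinear.
Variables (R : realType) (s : scalars).
Local Notation K := (scalar_field R s).

Section Make.
Variables (X Y Z : normedModType K) (f : X -> Y -> Z).
Hypotheses (lf : forall y, linear (f ^~ y)) (lf' : forall x, linear (f x)).
Hypothesis bf : exists M : K, forall x y, `|f x y| <= M * `|x| * `|y|.

#[local] HB.instance Definition _ :=
  bilinear_isBilinear.Build K X Y Z *:%R *:%R f (lf, lf').

Definition mk_bounded_bilinear : bounded_bilinear X Y Z :=
  @BoundedBilinear _ _ _ _ f bf.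

End Make.

Section Theory.
Variables (X Y Z : normedModType K) (m : bounded_bilinear X Y Z).

Lemma bbmap_linearl y : linear (m^~ y).
Proof. by move=> a x x'; rewrite linearPl. Qed.

Lemma bbmap_linearr x : linear (m x).
Proof. by move=> a y y'; rewrite linearPr. Qed.

Lemma bbmap_bound :
  exists2 M : K, 0 <= M & forall x y, `|m x y| <= M * `|x| * `|y|.
Proof.
have [M hM] := bbmapP m.
have [h|/existsNP[x /existsNP[y /eqP mxy]]] :=
  pselect (forall x y, m x y = 0).
  by exists 0 => // x y; rewrite h normr0 !mul0r.
exists M => //.
have x0 : 0 < `|x|.
  rewrite normr_gt0; apply: contra_neq mxy => ->; exact: linear0l.
have y0 : 0 < `|y|.
  rewrite normr_gt0; apply: contra_neq mxy => ->; exact: linear0r.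
rewrite -(pmulr_lge0 _ x0) -(pmulr_lge0 _ y0).
exact: le_trans (hM x y).
Qed.

End Theory.

Section Transpose.
Variables (X Y Z : normedModType K) (m : bounded_bilinear X Y Z).

Lemma transpose_bound :
  exists M : K, forall y x, `|m x y| <= M * `|y| * `|x|.
Proof. by have [M hM] := bbmapP m; exists M => y x; rewrite mulrAC. Qed.

Definition transpose : bounded_bilinear Y X Z :=
  mk_bounded_bilinear (bbmap_linearr m) (bbmap_linearl m) transpose_bound.

End Transpose.

Section Adjoint.
Variables (X Y Z : normedModType K) (m : bounded_bilinear X Y Z).

Lemma adjoint_fun_linear (z' : dual Z) (x : X) :
  linear ((fun y => z' (m x y)) : Y -> K^o).
Proof. by move=> a y1 y2; rewrite linearPr linearP. Qed.

Lemma adjoint_fun_bounded (z' : dual Z) (x : X) :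
  bounded_operator ((fun y => z' (m x y)) : Y -> K^o).
Proof.
have [M M0 hM] := bbmap_bound m; exists (dual_norm z' * (M * `|x|)) => y.
rewrite (le_trans (dual_norm_le _ _))// -mulrA ler_wpM2l ?dual_norm_ge0//.
Qed.

Definition adjoint_fun (z' : dual Z) (x : X) : dual Y :=
  mk_dual (adjoint_fun_linear z' x) (adjoint_fun_bounded z' x).

Lemma adjoint_linearl (x : X) : linear (adjoint_fun^~ x).
Proof. by move=> a f g; apply: dual_ext => y. Qed.

Lemma adjoint_linearr (z' : dual Z) : linear (adjoint_fun z').
Proof.
move=> a x1 x2; apply: dual_ext => y.
rewrite -[LHS]/(z' (m (a *: x1 + x2) y)) linearPl linearP.
by [].
Qed.

Lemma adjoint_bound : exists M : K,
  forall z' x, `|adjoint_fun z' x| <= M * `|z'| * `|x|.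
Proof.
have [M M0 hM] := bbmap_bound m; exists M => z' x.
apply: dual_norm_min => [|y]; first by rewrite !mulr_ge0.
apply: le_trans (dual_norm_le z' (m x y)) _.
by rewrite (mulrC M) -2!mulrA ler_wpM2l ?dual_norm_ge0// mulrA.
Qed.

Definition adjoint : bounded_bilinear (dual Z) X (dual Y) :=
  mk_bounded_bilinear adjoint_linearl adjoint_linearr adjoint_bound.

End Adjoint.

Section Arens.
Variables (X Y Z : normedModType K) (m : bounded_bilinear X Y Z).

Definition arens_extension :
    bounded_bilinear (dual (dual X)) (dual (dual Y)) (dual (dual Z)) :=
  adjoint (adjoint (adjoint m)).

End Arens.

Section Canon.
Variable X : normedModType K.

Lemma bidual_embedding_linear (x : X) : linear ((fun f => f x) : dual X -> K^o).
Proof. by []. Qed.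

Lemma bidual_embedding_bounded (x : X) :
  bounded_operator ((fun f => f x) : dual X -> K^o).
Proof. by exists `|x| => f; rewrite mulrC dual_norm_le. Qed.

Definition bidual_embedding (x : X) : dual (dual X) :=
  mk_dual (bidual_embedding_linear x) (bidual_embedding_bounded x).

End Canon.

Section Regularity.
Variables (X Y Z : normedModType K) (m : bounded_bilinear X Y Z).

Definition arens_regular : Prop :=
  (arens_extension m : dual (dual X) -> dual (dual Y) -> dual (dual Z)) =
  transpose (arens_extension (transpose m)).

Definition topological_center1 : set (dual (dual X)) :=
  [set x'' | continuous
     (arens_extension m x'' : weak_star (dual Y) -> weak_star (dual Z))].

Definition left_strongly_arens_irregular : Prop :=
  topological_center1 = range (@bidual_embedding X).

End Regularity.

End Bilinear.

(* Banach algebras are not assumed to be unital, so the product is not the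
   multiplication of a ring structure. *)
HB.mixin Record CompleteNormedModule_isBanachAlgebra (K : numFieldType) A
    & CompleteNormedModule K A := {
  bmul : A -> A -> A ;
  bmulA : associative bmul ;
  bmul_linearl : forall b : A, linear (bmul^~ b) ;
  bmul_linearr : forall a : A, linear (bmul a) ;
  bmul_norm : forall a b : A, `|bmul a b| <= `|a| * `|b| }.

#[short(type="banachAlgType")]
HB.structure Definition BanachAlgebra (K : numFieldType) :=
  {A of CompleteNormedModule K A & CompleteNormedModule_isBanachAlgebra K A}.

Record banach_bimodule (K : numFieldType) (A : banachAlgType K)
    (X : completeNormedModType K) := BanachBimodule {
  lact : bounded_bilinear A X X ;
  ract : bounded_bilinear X A X ;
  lact_bmul : forall a b x, lact (bmul a b) x = lact a (lact b x) ;
  ract_bmul : forall x a b, ract x (bmul a b) = ract (ract x a) b ;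
  lact_ract : forall a x b, ract (lact a x) b = lact a (ract x b) }.

Section BanachAlgebras.
Variables (R : realType) (s : scalars).
Local Notation K := (scalar_field R s).

Section Multiplication.
Variable B : banachAlgType K.

Lemma bmul_bound :
  exists M : K, forall a b : B, `|bmul a b| <= M * `|a| * `|b|.
Proof. by exists 1 => a b; rewrite mul1r bmul_norm. Qed.

Definition multiplication : bounded_bilinear B B B :=
  mk_bounded_bilinear (@bmul_linearl _ B) (@bmul_linearr _ B) bmul_bound.

Definition algebra_arens_regular : Prop := arens_regular multiplication.

Definition algebra_left_strongly_arens_irregular : Prop :=
  left_strongly_arens_irregular multiplication.

End Multiplication.

Section OperatorMultiplication.
Variables (A B : banachAlgType K) (T : {linear A -> B}).
Hypothesis bT : bounded_operator T.

Lemma opmul_linearl (b : B) : linear (fun a : A => bmul (T a) b).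
Proof. by move=> k a a'; rewrite linearP bmul_linearl. Qed.

Lemma opmul_linearr (a : A) : linear (bmul (T a)).
Proof. exact: bmul_linearr. Qed.

Lemma opmul_bound :
  exists M : K, forall (a : A) (b : B), `|bmul (T a) b| <= M * `|a| * `|b|.
Proof.
have [M hM] := bT; exists M => a b.
by rewrite (le_trans (bmul_norm _ _))// ler_wpM2r.
Qed.

Definition opmul : bounded_bilinear A B B :=
  mk_bounded_bilinear opmul_linearl opmul_linearr opmul_bound.

End OperatorMultiplication.

End BanachAlgebras.

(* Main.v *)
From HB Require Import structures.
Require Import Defs.
From mathcomp Require Import all_boot all_order all_algebra.
From mathcomp Require Import all_classical all_reals all_analysis.
From mathcomp Require Import complex ring.

Set Implicit Arguments.
Unset Strict Implicit.
Unset Printing Implicit Defensive.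

Import Order.TTheory GRing.Theory Num.Theory.
Import numFieldNormedType.Exports.

Local Open Scope classical_set_scope.
Local Open Scope ring_scope.

(** Write [pi] for the product of [B] and [T''] for the second adjoint of [T].
    Since [m a b = pi (T a) b], unfolding the three adjoints gives
    [m''' (phi, psi) = pi''' (T'' phi, psi)], and in the same way
    [m^t''' (psi, phi) = pi^t''' (psi, T'' phi)]. Hence regularity of [pi]
    implies that of [m], and an element [phi] lies in the topological center of
    [m] exactly when [T'' phi] lies in that of [pi], because the two maps whose
    continuity is asked are the same function.

    The other implications require [T''] to be onto when [T] is onto, and
    one-to-one when [T] is bijective. By the open mapping theorem
    ([bounded_preimage]) every [b] is some [T a] with [|a| <= C |b|].
    This gives [|f| <= C |f \o T|] on the dual of [B], so that every bounded
    functional on that dual factors through [f |-> f \o T] by the Hahn-Banach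
    theorem ([bounded_functional_factor]); that is, [T''] is onto
    ([bidual_map_onto]). If [T] is also injective, its inverse is bounded,
    every bounded functional on [A] has the form [f \o T], and [T''] is
    injective ([bidual_map_inj]). As [T''] extends [T] along the canonical
    embeddings, it then transports the equality of the topological center and
    the canonical image in both directions.

    Real and complex scalars are treated together. Norms lie in the scalar
    field, where the open mapping theorem replaces the Archimedean property by
    the existence of infima of sets of nonnegative scalars. For the Hahn-Banach
    theorem, a functional is recovered from its real part. *)

(** * Completeness and open mappings *)

Section Sequences.
Variables (R : realType) (s : scalars).
Local Notation K := (scalar_field R s).

(** Otherwise the infimum of the [c / 2 ^+ n] would be positive, yet at least
    twice itself. *)
Lemma geometric_lt (c e : K) : 0 <= c -> 0 < e -> exists n, c / 2 ^+ n < e.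
Proof.
move=> c0 e0; apply: contrapT => /forallNP ltN.
have ge0 n : 0 <= c / 2 ^+ n by rewrite divr_ge0// exprn_ge0.
have le_e n : e <= c / 2 ^+ n.
  have := ltN n; rewrite real_ltNge ?ger0_real ?(ltW e0)//.
  by move/negP; rewrite negbK.
have [||d [d_lb d_max]] :=
  @scalar_field_inf R s [set c / 2 ^+ n | n in [set: nat]].
- by exists (c / 2 ^+ 0), 0.
- by move=> _ [n _ <-].
have d2_lb : lbound [set c / 2 ^+ n | n in [set: nat]] (d * 2).
  move=> _ [n _ <-]; rewrite -ler_pdivlMr// -mulrA -invfM -exprSr.
  by apply: d_lb; exists n.+1.
have ed : e <= d by apply: d_max => _ [n _ <-].
have := d_max _ d2_lb; rewrite mulr_natr mulr2n gerDl => d_le0.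
by have := lt_le_trans e0 (le_trans ed d_le0); rewrite ltxx.
Qed.

(** The steps are dominated by a geometric series of ratio [1 / 2], whose tail
    from [n] on is at most [r n * 2]. *)
Lemma contracting_seq_cvg (X : completeNormedModType K) (u : nat -> X)
    (r : nat -> K) :
  (forall n, `|u n.+1 - u n| <= r n) -> (forall n, r n.+1 <= r n / 2) ->
  exists l : X, forall n, `|l - u n| <= r n * 2.
Proof.
move=> u_step r_step.
have r0 n : 0 <= r n := le_trans (normr_ge0 _) (u_step n).
have u_dist n k : `|u (n + k)%N - u n| <= (r n - r (n + k)%N) * 2.
  elim: k => [|k IH]; first by rewrite addn0 !subrr normr0 mul0r.
  rewrite addnS -(subrKA (u (n + k)%N)) (le_trans (ler_normD _ _))//.
  apply: le_trans (lerD (u_step _) IH) _.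
  rewrite -subr_ge0 (_ : _ - _ = r (n + k)%N - r (n + k).+1 * 2); last by ring.
  by rewrite subr_ge0 -ler_pdivlMr.
have u_near n k : (n <= k)%N -> `|u k - u n| <= r n * 2.
  move=> /subnKC <-; apply: le_trans (u_dist _ _) _.
  by rewrite ler_wpM2r// gerBl.
have r_geo n : r n <= r 0%N / 2 ^+ n.
  elim: n => [|n IH]; first by rewrite expr0 divr1.
  apply: le_trans (r_step n) _.
  by rewrite exprS invfM [_^-1 * _]mulrC mulrA ler_wpM2r.
have u_cauchy : cauchy (u @ \oo).
  apply: cauchy_exP => e e0.
  have [n ne] := geometric_lt (mulr_ge0 (r0 0%N) (ler0n _ 2)) e0.
  exists (u n); exists n => // k /= nk.
  rewrite -ball_normE/= distrC; apply: le_lt_trans (u_near _ _ nk) _.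
  apply: le_lt_trans ne; rewrite [leRHS]mulrAC ler_wpM2r//; exact: r_geo.
have /cauchy_cvgP/cvg_ex[l ul] := u_cauchy.
exists l => n; apply/ler_addgt0Pr => e e0.
have /cvgrPdist_lt/(_ e e0)[N _ Nu] := ul.
rewrite -(subrKA (u (maxn n N))) (le_trans (ler_normD _ _))// addrC lerD//.
  by apply: u_near; rewrite leq_maxl.
by apply/ltW/Nu; rewrite /= leq_maxr.
Qed.

End Sequences.

Lemma bounded_operator_ge0 (K : numFieldType) (X Y : normedModType K)
    (f : X -> Y) :
  bounded_operator f -> exists2 M : K, 0 <= M & forall x, `|f x| <= M * `|x|.
Proof.
move=> [M fM]; exists `|M| => // x.
have := fM x; rewrite -[_ * `|x|]ger0_norm ?normrM ?normr_id//.
exact: le_trans (fM x).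
Qed.

Section OpenMapping.
Variables (R : realType) (s : scalars).
Local Notation K := (scalar_field R s).
Variables (X Y : completeNormedModType K) (T : {linear X -> Y}).
Hypotheses (bT : bounded_operator T) (T_onto : forall y, exists x, T x = y).

(** Baire category argument: [Y] is the union of the images of the balls of
    radius [2 ^+ n], so one of these images is dense in some ball. If none were,
    shrinking balls [(y_n, r_n)] could be chosen with [y_n.+1] at distance more
    than [r_n.+1 * 2] from the [n]-th image; their limit would be outside the
    range of [T]. *)
Lemma range_ball_dense : exists (y0 : Y) (r M : K), [/\ 0 < r, 0 <= M &
  forall y, `|y - y0| <= r -> forall e, 0 < e ->
    exists2 x, `|x| <= M & `|y - T x| < e].
Proof.
apply: contrapT => no_ball.
have step (n : nat) (w : Y * {r : K | 0 < r}) : exists w' : Y * {r : K | 0 < r},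
    [/\ `|w'.1 - w.1| <= sval w.2, sval w'.2 <= sval w.2 / 2 &
     forall x, `|x| <= 2 ^+ n -> sval w'.2 * 2 < `|w'.1 - T x|].
  case: w => y [r r0] /=.
  have [y' [e [yy' e0 far]]] : exists (y' : Y) e, [/\ `|y' - y| <= r, 0 < e &
      forall x, `|x| <= 2 ^+ n -> e <= `|y' - T x|].
    apply: contrapT => close; apply: no_ball; exists y, r, (2 ^+ n).
    split=> // y' yy' e e0; apply: contrapT => far.
    apply: close; exists y', e; split=> // x xn.
    rewrite (real_leNgt (gtr0_real e0))//; apply/negP => ?; apply: far.
    by exists x.
  have [r' [r'0 r'r r'e]] : exists r', [/\ 0 < r', r' <= r / 2 & r' <= e / 2 / 2].
    have r20 : 0 < r / 2 by rewrite divr_gt0.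
    have e40 : 0 < e / 2 / 2 by rewrite !divr_gt0.
    have [re|er] := real_leP (gtr0_real r20) (gtr0_real e40).
      by exists (r / 2).
    by exists (e / 2 / 2); split=> //; exact: ltW.
  exists (y', exist _ r' r'0); split=> //= x xn.
  apply: lt_le_trans (far x xn); rewrite -ltr_pdivlMr//.
  apply: le_lt_trans r'e _.
  by rewrite ltr_pdivrMr// ltr_pMr ?divr_gt0// ltr1n.
have [next nextP] := choice (fun nw => step nw.1 nw.2).
pose w := fix w n := if n is k.+1 then next (k, w k)
  else (0, exist (fun r : K => 0 < r) 1 ltr01).
have wP n := nextP (n, w n).
have [||l l_near] := @contracting_seq_cvg R s Y
  (fun n => (w n).1) (fun n => sval (w n).2).
- by move=> n; have [] := wP n.
- by move=> n; have [] := wP n.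
have [x xl] := T_onto l.
have [n] := geometric_lt (normr_ge0 x) ltr01.
rewrite ltr_pdivrMr ?exprn_gt0// mul1r => /ltW xn.
have [_ _ /(_ x xn)] := wP n; rewrite xl distrC => /lt_le_trans/(_ (l_near n.+1)).
by rewrite ltxx.
Qed.

(** Density in one ball passes by translation and scaling to every point, with
    an approximation error proportional to the norm. *)
Lemma approximate_preimage : exists2 C : K, 0 <= C &
  forall y, exists2 x, `|x| <= C * `|y| & `|y - T x| <= `|y| / 2.
Proof.
have [y0 [r [M [r0 M0 dense]]]] := range_ball_dense.
exists (2 * M / r) => [|y]; first by rewrite divr_ge0 ?mulr_ge0// ltW.
have [->|y_neq0] := eqVneq y 0.
  exists 0; first by rewrite !normr0 mulr0.
  by rewrite linear0 subrr !normr0 mul0r.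
have y0' : 0 < `|y| by rewrite normr_gt0.
(* [y] is rescaled to norm [r], so that [y0] and [y0 + (r / |y|) y] both lie
   in the ball. *)
pose t : K := r / `|y|; have t0 : 0 < t by rewrite divr_gt0.
have e0 : 0 < r / 2 / 2 by rewrite !divr_gt0.
have [|x1 x1M Tx1] := dense y0 _ _ e0; first by rewrite subrr normr0 ltW.
have [|x2 x2M Tx2] := dense (y0 + t *: y) _ _ e0.
  by rewrite addrC addKr normrZ gtr0_norm// divfK ?gt_eqF.
exists (t^-1 *: (x2 - x1)).
  rewrite normrZ normfV (gtr0_norm t0) invf_div.
  rewrite [leRHS](_ : _ = `|y| / r * (2 * M)); last by rewrite mulrC mulrA mulrAC.
  rewrite ler_pM2l ?divr_gt0//.
  by rewrite (le_trans (ler_normB _ _))// mulr_natl mulr2n lerD.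
rewrite linearZ linearB/= -[y in X in X <= _](scalerK (lt0r_neq0 t0)) -scalerBr.
rewrite normrZ normfV (gtr0_norm t0) ler_pdivrMl//.
have -> : t *: y - (T x2 - T x1) = (y0 + t *: y - T x2) - (y0 - T x1).
  by rewrite !opprB -[y0 + _ - _]addrA [RHS]addrC addrA subrK addrCA.
rewrite (le_trans (ler_normB _ _))//.
have -> : t * (`|y| / 2) = r / 2 / 2 + r / 2 / 2.
  by rewrite mulrA divfK ?gt_eqF// -mulrDl -splitr.
by rewrite lerD// ltW.
Qed.

(** Open mapping theorem, in its quantitative form. Successive approximation:
    an approximate preimage of the current error is added to [u n], which halves
    the error. *)
Lemma bounded_preimage : exists2 C : K, 0 <= C &
  forall y, exists2 x, T x = y & `|x| <= C * `|y|.
Proof.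
have [C C0 approx] := approximate_preimage.
have [M M0 TM] := bounded_operator_ge0 bT.
exists (C * 2) => [|y]; first exact: mulr_ge0.
have approx' y' : exists x, `|x| <= C * `|y'| /\ `|y' - T x| <= `|y'| / 2.
  by have [x] := approx y'; exists x.
have [g gP] := choice approx'.
pose u := fix u n := if n is k.+1 then u k + g (y - T (u k)) else 0.
have u_err n : `|y - T (u n.+1)| <= `|y - T (u n)| / 2.
  by rewrite /= linearD opprD addrA; have [] := gP (y - T (u n)).
have err_geo n : `|y - T (u n)| <= `|y| / 2 ^+ n.
  elim: n => [|n IH]; first by rewrite /= linear0 subr0 expr0 divr1.
  apply: le_trans (u_err n) _.
  by rewrite exprS invfM [_^-1 * _]mulrC mulrA ler_wpM2r.
have [||x x_near] :=
  contracting_seq_cvg (u := u) (r := fun n => C * `|y - T (u n)|).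
- by move=> n; rewrite /= addrAC subrr add0r; have [] := gP (y - T (u n)).
- by move=> n; rewrite -mulrA ler_wpM2l.
exists x; last first.
  by have := x_near 0%N; rewrite /= linear0 !subr0 mulrAC.
apply/eqP; rewrite -subr_eq0 -normr_le0; apply/ler_addgt0Pl => e e0.
rewrite addr0.
have [||n ne] := @geometric_lt R s ((M * C * 2 + 1) * `|y|) e => //.
  by rewrite mulr_ge0// addr_ge0// !mulr_ge0.
apply: le_trans (ltW ne); rewrite -(subrKA (T (u n))) -linearB.
apply: le_trans (ler_normD _ _) _.
have Txu : `|T (x - u n)| <= M * C * 2 * `|y - T (u n)|.
  apply: le_trans (TM _) _; rewrite -!mulrA ler_wpM2l// [2 * _]mulrC mulrA.
  exact: x_near.
rewrite [`|T (u n) - y|]distrC.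
apply: le_trans (lerD Txu (lexx _)) _.
rewrite -{2}[`|y - T (u n)|]mul1r -mulrDl -[leRHS]mulrA.
by rewrite ler_wpM2l// addr_ge0// !mulr_ge0.
Qed.

End OpenMapping.

(** * Hahn-Banach theorem *)

Section Sublinear.
Variables (R : realType) (K : pzRingType) (iota : {rmorphism R -> K}).
Variable V : lmodType K.

(** Homogeneity is asked for nonnegative reals only, acting through [iota]; the
    scalars of [V] may thus be real or complex. The converse inequality follows,
    see [sublinear_scale]. *)
Definition sublinear (q : V -> R) : Prop :=
  (forall x y, q (x + y) <= q x + q y) /\
  (forall r x, 0 <= r -> q (iota r *: x) <= r * q x).

Lemma sublinear0 q : sublinear q -> q 0 = 0.
Proof.
move=> [qD qZ]; apply/le_anti/andP; split.
  by have := qZ 0 0 (lexx _); rewrite scaler0 mul0r.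
by have := qD 0 0; rewrite addr0 -subr_ge0 addrK.
Qed.

Lemma sublinear_scale q r x : sublinear q -> 0 <= r ->
  q (iota r *: x) = r * q x.
Proof.
move=> q_sub; rewrite le_eqVlt => /predU1P[<-|r0].
  by rewrite rmorph0 scale0r (sublinear0 q_sub) mul0r.
have [_ qZ] := q_sub; apply/le_anti; rewrite (qZ _ _ (ltW r0))/= -ler_pdivlMl//.
have := qZ r^-1 (iota r *: x); rewrite scalerA -rmorphM mulVf ?gt_eqF//.
by rewrite rmorph1 scale1r; apply; rewrite invr_ge0 ltW.
Qed.

Lemma sublinear_opp_ge q x : sublinear q -> - q (- x) <= q x.
Proof.
move=> q_sub; rewrite -subr_ge0 opprK -(sublinear0 q_sub) -[0 in leLHS](subrr x).
by have [qD _] := q_sub; rewrite qD.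
Qed.

Section Infimum.
Variables (I : Type) (D : set I) (F : I -> V -> R) (lb : V -> R).
Hypotheses (D0 : D !=set0) (Flb : forall i x, D i -> lb x <= F i x).

Let infF x := inf [set F i x | i in D].

Lemma inf_family_le i x : D i -> infF x <= F i x.
Proof.
move=> Di; apply: ge_inf; last by exists i.
by exists (lb x) => _ [j Dj <-]; exact: Flb.
Qed.

Lemma le_inf_family c x : (forall i, D i -> c <= F i x) -> c <= infF x.
Proof.
move=> cF; apply: lb_le_inf; first by have [i Di] := D0; exists (F i x), i.
by move=> _ [j Dj <-]; exact: cF.
Qed.

(** Infima of sublinear functionals need not be subadditive: nearly optimal
    indices for [x] and for [y] have to be merged into a single one for
    [x + y]. *)
Lemma inf_family_sublinear :
  (forall i j x y, D i -> D j ->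
     exists2 k, D k & F k (x + y) <= F i x + F j y) ->
  (forall i r x, D i -> 0 < r ->
     exists2 k, D k & F k (iota r *: x) <= r * F i x) ->
  (exists2 k, D k & F k 0 <= 0) ->
  sublinear infF.
Proof.
move=> FD FZ [k0 Dk0 F0]; split=> [x y|r x].
  rewrite -lerBlDr; apply: le_inf_family => i Di.
  rewrite lerBlDr [leRHS]addrC -lerBlDr; apply: le_inf_family => j Dj.
  rewrite lerBlDr [leRHS]addrC; have [k Dk] := FD i j x y Di Dj.
  by apply: le_trans; exact: inf_family_le.
rewrite le_eqVlt => /predU1P[<-|r0].
  rewrite rmorph0 scale0r mul0r; apply: le_trans F0; exact: inf_family_le.
rewrite -ler_pdivrMl//; apply: le_inf_family => i Di.
rewrite ler_pdivrMl//; have [k Dk] := FZ i r x Di r0.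
by apply: le_trans; exact: inf_family_le.
Qed.

End Infimum.

(** By Zorn's lemma: below [p], a chain is bounded pointwise from below by
    [x |-> - p (- x)], and its infimum is again sublinear. *)
Lemma minimal_sublinear (p : V -> R) : sublinear p ->
  exists q : V -> R, [/\ sublinear q, forall x, q x <= p x &
    forall q' : V -> R, sublinear q' -> (forall x, q' x <= q x) -> q' = q].
Proof.
move=> p_sub.
pose T := {q : V -> R | sublinear q /\ forall x, q x <= p x}.
have ext (q q' : T) : sval q = sval q' -> q = q'.
  case: q q' => [q hq] [q' hq'] /= qq'; case: _ / qq' hq' => hq'.
  by congr exist; exact: Prop_irrelevance.
have [||||[q [q_sub qp]] qmin] :=
  @Zorn T (fun q q' => `[< forall x, sval q' x <= sval q x >]).
- by move=> q; apply/asboolP => x.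
- move=> q1 q2 q3 /asboolP h12 /asboolP h23; apply/asboolP => x.
  exact: le_trans (h23 x) (h12 x).
- move=> q1 q2 /asboolP h12 /asboolP h21; apply: ext; apply/funext => x.
  by apply/le_anti; rewrite h21 h12.
- move=> C Ctot; have [C0|/set0P C0] := eqVneq C set0.
    by exists (exist _ p (conj p_sub (fun x => lexx _))) => s; rewrite C0.
  have Flb (c : T) x : C c -> - p (- x) <= sval c x.
    move: c => [c [c_sub cp]] _ /=; apply: le_trans (sublinear_opp_ge _ c_sub).
    by rewrite lerN2.
  pose q x := inf [set sval c x | c in C].
  have q_sub : sublinear q.
    apply: (inf_family_sublinear (lb := fun x => - p (- x))) => //.
    - move=> c d x y Cc Cd.
      have [/asboolP le_dc|/asboolP le_cd] := Ctot c d Cc Cd.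
        exists d => //; have [dD _] := (svalP d).1.
        by apply: le_trans (dD x y) _; rewrite lerD2r.
      exists c => //; have [cD _] := (svalP c).1.
      by apply: le_trans (cD x y) _; rewrite lerD2l.
    - move=> c r x Cc r0; exists c => //; have [_ cZ] := (svalP c).1.
      by apply: cZ; exact: ltW.
    - by have [c Cc] := C0; exists c => //; rewrite (sublinear0 (svalP c).1).
  have qC (c : T) x : C c -> q x <= sval c x.
    by move=> Cc; exact: (inf_family_le (lb := fun x => - p (- x))).
  have qp x : q x <= p x.
    have [c Cc] := C0; apply: le_trans (qC c x Cc) _; exact: (svalP c).2.
  by exists (exist _ q (conj q_sub qp)) => c Cc; apply/asboolP => x; exact: qC.
exists q; split=> // q' q'_sub q'q.
have q'p x : q' x <= p x := le_trans (q'q x) (qp x).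
have := qmin (exist _ q' (conj q'_sub q'p)) => /(_ _)/(congr1 sval); apply.
exact/asboolP.
Qed.

(** If [q] is minimal, then for each [y] the smaller sublinear functional
    [x |-> inf_(t >= 0) (q (x + t y) - t q y)] equals [q]; the
    term [t = 1] then gives [q x <= q (x + y) - q y]. *)
Lemma minimal_sublinear_additive (q : V -> R) : sublinear q ->
  (forall q' : V -> R, sublinear q' -> (forall x, q' x <= q x) -> q' = q) ->
  forall x y, q (x + y) = q x + q y.
Proof.
move=> q_sub qmin x y; have [qD _] := q_sub.
apply/le_anti; rewrite qD/=.
pose D := [set t : R | 0 <= t].
pose F t z := q (z + iota t *: y) - t * q y.
have D0 : D !=set0 by exists 0; exact: lexx.
have Flb t z : D t -> - q (- z) <= F t z.
  move=> t0; rewrite lerBrDr addrC lerBlDr -(sublinear_scale _ q_sub t0).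
  by rewrite -{1}[iota t *: y](addrK z) [_ + z]addrC qD.
have /qmin q'E : sublinear (fun z => inf [set F t z | t in D]).
  apply: (inf_family_sublinear (lb := fun x => - q (- x))) => //.
  - move=> t u z w t0 u0; exists (t + u); first exact: addr_ge0.
    rewrite /F addrACA -opprD -mulrDl lerD2r rmorphD scalerDl addrACA.
    exact: qD.
  - move=> t r z t0 r0; exists (r * t); first exact: mulr_ge0 (ltW r0) t0.
    rewrite /F rmorphM -scalerA -scalerDr (sublinear_scale _ q_sub (ltW r0)).
    by rewrite mulrBr mulrA.
  - exists 0; first exact: lexx.
    by rewrite /F rmorph0 scale0r mul0r addr0 subr0 (sublinear0 q_sub).
rewrite -lerBrDr -[in leLHS]q'E => [|z].
  have := inf_family_le Flb x (ler01 : D 1).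
  by rewrite /F rmorph1 scale1r mul1r.
have := inf_family_le Flb z (lexx 0 : D 0).
by rewrite /F rmorph0 scale0r mul0r addr0 subr0.
Qed.

(** Existence of real-linear functionals below [p]. To extend a functional given
    on a subspace it suffices to build its values into [p], as in
    [bounded_functional_factor]; partially defined functionals are avoided. *)
Lemma dominated_linear (p : V -> R) : sublinear p ->
  exists q : V -> R, [/\ forall x, q x <= p x,
    forall x y, q (x + y) = q x + q y &
    forall r x, q (iota r *: x) = r * q x].
Proof.
move=> /minimal_sublinear[q [q_sub qp qmin]].
have qD := minimal_sublinear_additive q_sub qmin.
have qN x : q (- x) = - q x.
  by apply/eqP; rewrite -addr_eq0 -qD addNr (sublinear0 q_sub).
exists q; split=> // r x; have [r0|r0] := leP 0 r.
  exact: sublinear_scale.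
rewrite -[r]opprK rmorphN scaleNr qN sublinear_scale ?mulNr//.
by rewrite oppr_ge0 ltW.
Qed.

End Sublinear.

Lemma Re_le_norm (R : rcfType) (z : R[i]) : complex.Re z <= complex.Re `|z|.
Proof.
have := normc_ge_Re z; rewrite lecE /= => /andP[_]; exact: le_trans (ler_norm _).
Qed.

Section RealPart.
Variable R : realType.

Definition real_embedding (s : scalars) : {rmorphism R -> scalar_field R s} :=
  match s with RealScalars => idfun | ComplexScalars => real_complex R end.

Definition real_part (s : scalars) : scalar_field R s -> R :=
  match s with RealScalars => fun x => x | ComplexScalars => @complex.Re R end.

Variable s : scalars.
Local Notation K := (scalar_field R s).
Local Notation iota := (real_embedding s).
Local Notation re := (@real_part s).

Lemma real_partD a b : re (a + b) = re a + re b.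
Proof. by rewrite /real_part; case: s a b => // -[? ?] [? ?]. Qed.

Lemma real_partM r a : re (iota r * a) = r * re a.
Proof.
rewrite /real_part /real_embedding; case: s a => // -[x y] /=.
by rewrite mul0r subr0.
Qed.

Lemma real_part0 : re 0 = 0.
Proof. by have := real_partM 0 0; rewrite rmorph0 !mul0r. Qed.

Lemma real_partN a : re (- a) = - re a.
Proof. by rewrite /real_part; case: s a => // -[? ?]. Qed.

Lemma le_real_part a b : a <= b -> re a <= re b.
Proof.
by rewrite /real_part; case: s a b => //= -[? ?] [? ?]; rewrite lecE => /andP[].
Qed.

Lemma real_part_le_norm a : re a <= re `|a|.
Proof.
rewrite /real_part; case: s a => a; [exact: ler_norm | exact: Re_le_norm].
Qed.

Lemma real_part_ge0K a : 0 <= a -> iota (re a) = a.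
Proof.
rewrite /real_part /real_embedding; case: s a => //= -[x y].
by rewrite lecE /= => /andP[/eqP -> _].
Qed.

Lemma norm_real_embedding r : 0 <= r -> `|iota r| = iota r.
Proof.
move=> r0; apply: ger0_norm.
by rewrite /real_embedding; case: s => //=; rewrite lecR.
Qed.

End RealPart.

Section HahnBanach.
Variables (R : realType) (s : scalars).
Local Notation K := (scalar_field R s).
Local Notation iota := (real_embedding R s).
Local Notation re := (@real_part R s).

(** Over the complex numbers the functional is [x |-> q x - i q (i x)]. *)
Lemma functional_of_real_part (X : normedModType K) (q : X -> R) (C : K) :
  0 <= C ->
  (forall x y, q (x + y) = q x + q y) ->
  (forall r x, q (iota r *: x) = r * q x) ->
  (forall x, q x <= re (C * `|x|)) ->
  exists psi : dual X, forall x, re (psi x) = q x.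
Proof.
move=> C0 qD qZ qC.
have qN x : q (- x) = - q x by rewrite -scaleN1r -(rmorphN1 iota) qZ mulN1r.
have q_norm x : iota `|q x| <= C * `|x|.
  rewrite -[leRHS](real_part_ge0K (mulr_ge0 C0 (normr_ge0 x))).
  have : `|q x| <= re (C * `|x|).
    rewrite ler_norml qC andbT lerNl -qN.
    by have := qC (- x); rewrite normrN.
  rewrite /real_embedding; case: s X q C C0 qD qZ qC qN x => //= *.
  by rewrite lecR.
move: q_norm qD qZ {qN}; rewrite /real_part /real_embedding.
case: s X q C C0 qC => /= X q C C0 _ q_norm qD qZ.
  have q_lin : linear (q : X -> R^o) by move=> r x y; rewrite qD qZ.
  have q_bd : bounded_operator (q : X -> R^o) by exists C.
  by exists (@mk_dual R RealScalars X q q_lin q_bd).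
pose f (x : X) : R[i]^o := Complex (q x) (- q ('i%C *: x)).
have f_lin : linear f.
  move=> [u v] x y.
  have aE : Complex u v = u%:C%C + v%:C%C * 'i%C by simpc.
  have iaE : 'i%C * Complex u v = u%:C%C * 'i%C + (- v)%:C%C by simpc.
  have q_re : q (Complex u v *: x) = u * q x + v * q ('i%C *: x).
    by rewrite aE scalerDl qD -scalerA !qZ.
  have q_im : q ('i%C *: (Complex u v *: x)) = u * q ('i%C *: x) - v * q x.
    by rewrite scalerA iaE scalerDl qD -scalerA !qZ mulNr.
  rewrite /f scalerDr !qD q_re q_im.
  rewrite -[RHS]/(Complex u v * f x + f y); apply/eqP; rewrite eq_complex /=.
  by apply/andP; split; apply/eqP; ring.
have f_bd : bounded_operator f.
  exists (C * 2) => x.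
  have -> : f x = (q x)%:C%C - 'i%C * (q ('i%C *: x))%:C%C by simpc.
  apply: le_trans (ler_normB _ _) _.
  have norm_re (a : R) : `|a%:C%C| = `|a|%:C%C.
    by rewrite normc_def /= expr0n addr0 sqrtr_sqr.
  have norm_i : `|'i%C : R[i]| = 1.
    by rewrite normc_def /= expr0n add0r expr1n sqrtr1.
  rewrite normrM norm_i mul1r !norm_re mulrAC mulr_natr mulr2n lerD//.
  by apply: le_trans (q_norm _) _; rewrite normrZ norm_i mul1r.
by exists (@mk_dual R ComplexScalars X f f_lin f_bd).
Qed.

(** A functional is determined by its real part, since the imaginary part at
    [x] is minus the real part at ['i *: x]. *)
Lemma linear_real_part_inj (X : normedModType K) (f g : X -> K^o) :
  linear f -> linear g -> (forall x, re (f x) = re (g x)) -> forall x, f x = g x.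
Proof.
rewrite /real_part; case: s X f g => //= X f g f_lin g_lin fg x.
have f_i : f ('i%C *: x) = f x * 'i%C by rewrite (scalable_linear f_lin) mulrC.
have g_i : g ('i%C *: x) = g x * 'i%C by rewrite (scalable_linear g_lin) mulrC.
apply/eqP; rewrite eq_complex fg eqxx/=; apply/eqP/oppr_inj.
by rewrite -!ReiNIm -f_i -g_i.
Qed.

(** Hahn-Banach theorem: the hypothesis says that [phi] induces a bounded
    functional on the range of [S], and [psi] extends it. The real part of [psi]
    is a real-linear functional [q] below
    [p x = inf_y (re (phi y) + C |x - S y|)]. The value at [y = 0] gives
    [q x <= C |x|]; at [x = S y] it gives [q (S y) <= re (phi y)], hence
    equality, by replacing [y] with [- y]. *)
Theorem bounded_functional_factor (X Y : normedModType K) (S : {linear Y -> X})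
    (phi : dual Y) (C : K) : 0 <= C ->
  (forall y, `|phi y| <= C * `|S y|) ->
  exists psi : dual X, forall y, psi (S y) = phi y.
Proof.
move=> C0 phiC.
pose F y x := re (phi y) + re (C * `|x - S y|).
pose p x := inf [set F y x | y in [set: Y]].
have Y0 : [set: Y] !=set0 by exists 0.
have Flb (y : Y) x : [set: Y] y -> - re (C * `|x|) <= F y x.
  move=> _; rewrite lerNl opprD -real_partN lerBlDr -real_partD.
  apply: le_trans (real_part_le_norm _) _; apply: le_real_part.
  rewrite normrN (le_trans (phiC y))// -mulrDr ler_wpM2l//.
  rewrite -{1}[S y](subKr x); exact: ler_normB.
have p_sub : sublinear iota p.
  apply: (inf_family_sublinear (lb := fun x => - re (C * `|x|))) => //.
  - move=> y z x x' _ _; exists (y + z) => //.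
    rewrite /F linearD real_partD addrACA lerD2l -real_partD le_real_part//.
    rewrite -mulrDr ler_wpM2l// linearD opprD addrACA; exact: ler_normD.
  - move=> y r x _ r0; exists (iota r *: y) => //.
    rewrite /F [S _]linearZ [phi _]linearZ /= -scalerBr normrZ.
    rewrite (norm_real_embedding _ (ltW r0)).
    by rewrite mulrCA !real_partM mulrDr.
  - exists 0 => //; rewrite /F [S 0]linear0 [phi 0]linear0 subrr normr0.
    by rewrite mulr0 real_part0 addr0.
have [q [qp qD qZ]] := dominated_linear p_sub.
have qF y x : q x <= F y x.
  apply: le_trans (qp x) _.
  exact: (inf_family_le (lb := fun x => - re (C * `|x|))).
have [x|psi psiE] := functional_of_real_part C0 qD qZ.
  have := qF 0 x.
  by rewrite /F [S 0]linear0 [phi 0]linear0 real_part0 add0r subr0.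
exists psi; apply: (@linear_real_part_inj Y (psi \o S) phi).
- by move=> a x y /=; rewrite !linearP.
- exact: dual_linear.
move=> y /=; rewrite psiE.
have qS z : q (S z) <= re (phi z).
  by have := qF z (S z); rewrite /F subrr normr0 mulr0 real_part0 addr0.
apply/le_anti; rewrite qS/= -lerN2 -real_partN -linearN.
have <- : q (S (- y)) = - q (S y); last exact: qS.
by rewrite linearN -scaleN1r -(rmorphN1 iota) qZ mulN1r.
Qed.

End HahnBanach.

(** * Second adjoints of onto operators *)

Section DualMap.
Variables (R : realType) (s : scalars).
Local Notation K := (scalar_field R s).
Variables (X Y : normedModType K) (T : {linear X -> Y}).
Hypothesis bT : bounded_operator T.

Lemma dual_map_fun_linear (f : dual Y) : linear (f \o T : X -> K^o).
Proof. by move=> a x y /=; rewrite !linearP. Qed.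

Lemma dual_map_fun_bounded (f : dual Y) : bounded_operator (f \o T : X -> K^o).
Proof.
have [M M0 TM] := bounded_operator_ge0 bT.
exists (dual_norm f * M) => x; apply: le_trans (dual_norm_le f _) _.
by rewrite -mulrA ler_wpM2l ?dual_norm_ge0.
Qed.

Definition dual_map (f : dual Y) : dual X :=
  mk_dual (dual_map_fun_linear f) (dual_map_fun_bounded f).

Lemma dual_map_linear : linear dual_map.
Proof. by move=> a f g; apply: dual_ext. Qed.

HB.instance Definition _ :=
  GRing.isLinear.Build K (dual Y) (dual X) *:%R dual_map dual_map_linear.

Lemma dual_map_bounded : bounded_operator dual_map.
Proof.
have [M M0 TM] := bounded_operator_ge0 bT.
exists M => f; rewrite mulrC; apply: dual_norm_min => [|x].
  by rewrite mulr_ge0.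
apply: le_trans (dual_norm_le f _) _.
by rewrite -mulrA ler_wpM2l ?dual_norm_ge0.
Qed.

End DualMap.

Definition bidual_map (R : realType) (s : scalars)
    (X Y : normedModType (scalar_field R s)) (T : {linear X -> Y})
    (bT : bounded_operator T) : dual (dual X) -> dual (dual Y) :=
  dual_map (dual_map_bounded bT).

Section OntoMaps.
Variables (R : realType) (s : scalars).
Local Notation K := (scalar_field R s).
Variables (X Y : completeNormedModType K) (T : {linear X -> Y}).
Hypotheses (bT : bounded_operator T) (T_onto : forall y, exists x, T x = y).

(** The open mapping theorem makes [dual_map bT] bounded below, so that [phi]
    factors through it. *)
Lemma bidual_map_onto (phi : dual (dual Y)) : exists psi, bidual_map bT psi = phi.
Proof.
have [C C0 preim] := bounded_preimage bT T_onto.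
have T'_below (f : dual Y) : `|f| <= C * `|dual_map bT f|.
  apply: dual_norm_min => [|y]; first by rewrite mulr_ge0.
  have [x <- xC] := preim y.
  apply: le_trans (dual_norm_le (dual_map bT f) x) _.
  by rewrite [C * _]mulrC -mulrA ler_wpM2l ?dual_norm_ge0.
have phi_bound f : `|phi f| <= dual_norm phi * C * `|dual_map bT f|.
  apply: le_trans (dual_norm_le phi f) _.
  by rewrite -mulrA ler_wpM2l ?dual_norm_ge0.
have [|psi psiE] := bounded_functional_factor _ phi_bound.
  by rewrite mulr_ge0 ?dual_norm_ge0.
by exists psi; apply: dual_ext => f; exact: psiE.
Qed.

(** The required [f] is [g] composed with the inverse of [T], which is bounded by
    the open mapping theorem. *)
Lemma dual_map_onto (g : dual X) : injective T -> exists f, dual_map bT f = g.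
Proof.
move=> T_inj; have [C C0 preim] := bounded_preimage bT T_onto.
have [Tinv TinvK] := choice T_onto.
have T_invK : cancel T Tinv by move=> x; apply: T_inj; rewrite TinvK.
have f_lin : linear (g \o Tinv : Y -> K^o).
  move=> a y z /=; rewrite -linearP; congr (g _); apply: T_inj.
  by rewrite linearP !TinvK.
have f_bd : bounded_operator (g \o Tinv : Y -> K^o).
  exists (dual_norm g * C) => y /=; apply: le_trans (dual_norm_le g _) _.
  have [x <- xC] := preim y.
  by rewrite T_invK -mulrA ler_wpM2l ?dual_norm_ge0.
by exists (mk_dual f_lin f_bd); apply: dual_ext => x /=; rewrite T_invK.
Qed.

(** Two elements of the bidual with the same image agree on the range of
    [dual_map bT], which is everything. *)
Lemma bidual_map_inj : injective T -> injective (bidual_map bT).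
Proof.
move=> T_inj psi psi' eq_psi; apply: dual_ext => g.
have [f <-] := dual_map_onto g T_inj.
exact: (congr1 (fun phi : dual (dual Y) => phi f) eq_psi).
Qed.

End OntoMaps.

(** * Arens extensions of composed bilinear maps *)

Lemma arens_regularP (R : realType) (s : scalars)
    (X Y Z : normedModType (scalar_field R s)) (m : bounded_bilinear X Y Z) :
  arens_regular m <-> forall phi psi,
    arens_extension m phi psi = arens_extension (transpose m) psi phi.
Proof.
split=> [m_reg phi psi|m_reg]; first by rewrite m_reg.
by apply/funext => phi; apply/funext => psi; exact: m_reg.
Qed.

Section LeftComposition.
Variables (R : realType) (s : scalars).
Local Notation K := (scalar_field R s).
Variables (X Y Z W : normedModType K) (T : {linear X -> Y}).
Hypothesis bT : bounded_operator T.
Variables (m : bounded_bilinear Y Z W) (mT : bounded_bilinear X Z W).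
Hypothesis mTE : forall x z, mT x z = m (T x) z.

Lemma bidual_map_embedding x :
  bidual_map bT (bidual_embedding x) = bidual_embedding (T x).
Proof. exact: dual_ext. Qed.

(** Stated for [arens_extension mT phi] as a function of the second argument, so
    that it also compares the continuity conditions defining the topological
    centers. *)
Lemma arens_extension_comp phi :
  arens_extension mT phi = arens_extension m (bidual_map bT phi) :> (_ -> _).
Proof.
apply/funext => psi; apply: dual_ext => w'; congr (phi _).
apply: dual_ext => x; congr (psi _); apply: dual_ext => z.
by congr (w' _); exact: mTE.
Qed.

Lemma arens_extension_transpose_comp psi phi :
  arens_extension (transpose mT) psi phi =
  arens_extension (transpose m) psi (bidual_map bT phi).
Proof.
apply: dual_ext => w'; congr (psi _).
apply: dual_ext => z; congr (phi _); apply: dual_ext => x.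
by congr (w' _); exact: mTE.
Qed.

Lemma arens_regular_comp : arens_regular m -> arens_regular mT.
Proof.
move=> /arens_regularP m_reg; apply/arens_regularP => phi psi.
by rewrite arens_extension_comp arens_extension_transpose_comp m_reg.
Qed.

Lemma arens_regular_of_comp :
  (forall phi, exists psi, bidual_map bT psi = phi) ->
  arens_regular mT -> arens_regular m.
Proof.
move=> T''_onto /arens_regularP mT_reg; apply/arens_regularP => phi psi.
have [phi' <-] := T''_onto phi.
by rewrite -arens_extension_comp -arens_extension_transpose_comp mT_reg.
Qed.

Lemma topological_center1_comp phi :
  topological_center1 mT phi = topological_center1 m (bidual_map bT phi).
Proof. by rewrite /topological_center1 /mkset arens_extension_comp. Qed.

(** That the canonical image of [Y] lies in the center of [m] also follows from
    the hypothesis on [mT], as each [y] is the image of some [x]. *)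
Lemma left_strongly_arens_irregular_of_comp :
  (forall phi, exists psi, bidual_map bT psi = phi) ->
  (forall y, exists x, T x = y) ->
  left_strongly_arens_irregular mT -> left_strongly_arens_irregular m.
Proof.
move=> T''_onto T_onto mT_irr; apply/seteqP; split=> [phi|_ [y _ <-]].
  have [psi <-] := T''_onto phi; rewrite -topological_center1_comp mT_irr.
  by move=> [x _ <-]; exists (T x) => //; rewrite bidual_map_embedding.
have [x <-] := T_onto y.
by rewrite -bidual_map_embedding -topological_center1_comp mT_irr; exists x.
Qed.

Lemma left_strongly_arens_irregular_comp :
  injective (bidual_map bT) -> (forall y, exists x, T x = y) ->
  left_strongly_arens_irregular m -> left_strongly_arens_irregular mT.
Proof.
move=> T''_inj T_onto m_irr; apply/seteqP; split=> [phi|_ [x _ <-]].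
  rewrite topological_center1_comp m_irr => -[y _]; have [x <-] := T_onto y.
  by rewrite -bidual_map_embedding => /T''_inj <-; exists x.
by rewrite topological_center1_comp m_irr bidual_map_embedding; exists (T x).
Qed.

End LeftComposition.

Theorem mainTheorem1 (R : realType) (s : scalars)
    (A B : banachAlgType (scalar_field R s)) (bimod : banach_bimodule A B)
    (T : {linear A -> B}) (bT : bounded_operator T) :
  let m := opmul bT in
  (algebra_arens_regular B -> arens_regular m) /\
  (set_surj [set: A] [set: B] T ->
     (algebra_arens_regular B <-> arens_regular m) /\
     (left_strongly_arens_irregular m ->
        algebra_left_strongly_arens_irregular B) /\
     (injective T ->
        (algebra_left_strongly_arens_irregular B <->
         left_strongly_arens_irregular m))).
Proof.
move=> m.
have mE x z : m x z = multiplication B (T x) z by [].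
split; first exact: (arens_regular_comp bT mE).
move=> T_surj.
have T_onto y : exists x, T x = y by have [x _ <-] := T_surj y Logic.I; exists x.
have T''_onto := bidual_map_onto bT T_onto.
split; first split.
- exact: (arens_regular_comp bT mE).
- exact: (arens_regular_of_comp mE T''_onto).
split; first exact: (left_strongly_arens_irregular_of_comp mE T''_onto T_onto).
move=> T_inj; split.
  apply: (left_strongly_arens_irregular_comp mE _ T_onto).
  exact: (bidual_map_inj T_onto T_inj).
exact: (left_strongly_arens_irregular_of_comp mE T''_onto T_onto).
Qed.
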